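(* Let $\phi=\frac{1+\sqrt5}{2}$ be the golden mean. The dynamical system given by the map $$\left(\mathbb R/\mathbb Z\right)^2\longrightarrow\left(\mathbb R/\mathbb Z\right)^2,\qquad (y,z)\mapsto\left(y+\frac1{\phi^2},\ z+y-\frac1{2\phi^3}\right)$$ is self-induced, minimal and uniquely ergodic.
   Context: A measure-preserving dynamical system $(Y,T,\mu)$ (here $\mu$ is Lebesgue measure on the torus) is called self-induced if there is a measurable subset $A\subset Y$ with $0<\mu(A)<\mu(Y)$ such that the first return map of $T$ to $A$ (defined by $T_A(y)=T^{n(y)}(y)$ with $n(y)=\min\{n\ge1: T^n(y)\in A\}$), equipped with the normalized restriction of $\mu$ to $A$, is measurably conjugate to $(Y,T,\mu)$ with $\mu$ normalized, i.e. conjugate by a bi-measurable, measure-preserving bijection defined up to null sets. *)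

(* Defs.v *)
From HB Require Import structures.
From mathcomp Require Import all_boot all_order all_algebra.
From mathcomp Require Import all_classical all_reals all_analysis.
From mathcomp Require Import measurable_realfun.
From mathcomp Require Import generic_quotient ring_quotient.

Set Implicit Arguments.
Unset Strict Implicit.
Unset Printing Implicit Defensive.

Import Order.TTheory GRing.Theory Num.Theory.
Import numFieldNormedType.Exports.

Local Open Scope classical_set_scope.
Local Open Scope ring_scope.
Local Open Scope quotient_scope.

(* The qualifier [Num.int] carries its closure instances on the underlying
   predicate [Num.int_num_subdef], so this is the zmodType R / Z. *)
Definition circle (R : realType) : Type :=
  Quotient.quot (GRing.ZmodClosed.clone R (@Num.int_num_subdef R) _).

Section circle.
Context {R : realType}.

HB.instance Definition _ := GRing.Zmodule.on (circle R).
HB.instance Definition _ := EqQuotient.on (circle R).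

Definition to_circle (x : R) : circle R := \pi x.

Let circle_op (U : set (circle R)) := open (to_circle @^-1` U).
Let circle_opT : circle_op setT.
Proof. by rewrite /circle_op preimage_setT; exact: openT. Qed.
Let circle_opI : setI_closed circle_op.
Proof. by move=> A B oA oB; rewrite /circle_op preimage_setI; exact: openI. Qed.
Let circle_op_bigU (I : Type) (f : I -> set (circle R)) :
  (forall i, circle_op (f i)) -> circle_op (\bigcup_i f i).
Proof.
by move=> fo; rewrite /circle_op preimage_bigcup; apply: bigcup_open => i _;
  exact: fo.
Qed.

HB.instance Definition _ := isPointed.Build (circle R) 0.
HB.instance Definition _ := @isOpenTopological.Build (circle R)
  circle_op circle_opT circle_opI circle_op_bigU.

Lemma circle_openE (U : set (circle R)) : open U = open (to_circle @^-1` U).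
Proof. by []. Qed.

HB.instance Definition _ := @isMeasurable.Build (sigma_display (@open (circle R)))
  (circle R) <<s (@open (circle R)) >> (@sigma_algebra0 _ setT _)
  (@sigma_algebraC _ _) (@sigma_algebra_bigcup _ setT _).

Lemma measurable_to_circle : measurable_fun setT to_circle.
Proof.
apply: (@measurability _ _ _ _ setT _ (@open (circle R))) => //.
by move=> _ [B oB <-]; rewrite setTI; apply: open_measurable.
Qed.

End circle.

Lemma open_to_circle (R : realType) (U : set R) :
  open U -> open (to_circle @` U).
Proof.
move=> oU; rewrite circle_openE.
have -> : to_circle @^-1` (to_circle @` U) =
    \bigcup_(m : int) (fun x => x + m%:~R) @^-1` U.
  apply/seteqP; split => [x [y Uy yx]|x [m _ /= Uxm]].
    have /eqP := yx; rewrite /to_circle -Quotient.idealrBE => /intrP[m ymx].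
    by exists m => //=; rewrite -ymx addrC subrK.
  exists (x + m%:~R) => //; apply/eqP; rewrite -Quotient.idealrBE addrC addKr.
  exact: intr_int.
apply: bigcup_open => m _; apply: open_comp => // x _.
by apply: cvgD; [exact: cvg_id|exact: cvg_cst].
Qed.

(* The torus R/Z x R/Z carries the product topology and the product
   sigma-algebra; the latter is the Borel sigma-algebra of the former. *)
Lemma measurable_torusE (R : realType) :
  @measurable _ (circle R * circle R)%type =
  <<s (@open (circle R * circle R)%type) >>.
Proof.
apply/seteqP; split.
  apply: smallest_sub; first exact: smallest_sigma_algebra.
  have sub (pr : circle R * circle R -> circle R) : continuous pr ->
      preimage_set_system setT pr measurable `<=`
      <<s (@open (circle R * circle R)%type) >>.
    move=> /continuousP cpr _ [A mA <-].
    have : measurable `<=` image_set_system setT pr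
        <<s (@open (circle R * circle R)%type) >>.
      apply: smallest_sub; first exact/sigma_algebra_image/smallest_sigma_algebra.
      move=> U oU; rewrite /image_set_system /= setTI.
      by apply: sub_sigma_algebra; exact: cpr.
    exact.
  rewrite subUset; split; apply: sub => x; [exact: cvg_fst|exact: cvg_snd].
apply: smallest_sub; first exact: sigma_algebra_measurable.
move=> U oU.
pose I := (rat * rat * rat * rat)%type.
pose J (i : I) : set (circle R) := to_circle @` `]ratr i.1.1.1, ratr i.1.1.2[.
pose K (i : I) : set (circle R) := to_circle @` `]ratr i.1.2, ratr i.2[.
have mJ (a b : rat) : measurable (to_circle @` `](ratr a : R), ratr b[).
  by apply: sub_sigma_algebra; apply: open_to_circle; exact: interval_open.
suff -> : U = \bigcup_(i : I) (if `[< J i `*` K i `<=` U >]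
                               then J i `*` K i else set0).
  apply: countable_bigcupT_measurable => [|i]; first exact: countableP.
  by case: ifPn => // _; apply: measurableX; exact: mJ.
apply/seteqP; split; last by move=> p [i _]; case: asboolP => // /[apply].
move=> [p q] Upq.
have [[A B] [/= nA nB] AB] : nbhs (p, q) U by exact: open_nbhs_nbhs.
have ratnbhs (c : circle R) (V : set (circle R)) : nbhs c V -> exists i : rat * rat,
    (to_circle @` `](ratr i.1 : R), ratr i.2[) c /\
    to_circle @` `](ratr i.1 : R), ratr i.2[ `<=` V.
  rewrite nbhsE => -[W [oW Wc] WV].
  have cE : to_circle (repr c) = c by exact: reprK.
  have : nbhs (repr c) (to_circle @^-1` W).
    by apply: open_nbhs_nbhs; split; [exact: oW|rewrite /= cE].
  move=> /nbhs_ballP[e /= e0 eW].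
  have /rat_in_itvoo[a] : repr c - e < repr c by rewrite ltrBlDr ltrDl.
  rewrite in_itv /= => /andP[a1 a2].
  have /rat_in_itvoo[b] : repr c < repr c + e by rewrite ltrDl.
  rewrite in_itv /= => /andP[b1 b2].
  exists (a, b); split => /=; first by exists (repr c) => //=; rewrite in_itv /= a2.
  move=> _ [x /= + <-]; rewrite in_itv /= => /andP[ax xb].
  apply/WV/eW; rewrite /ball /= distrC ltr_distl.
  by rewrite (lt_trans a1 ax) (lt_trans xb b2).
have [i [Ai iA]] := ratnbhs _ _ nA; have [j [Bj jB]] := ratnbhs _ _ nB.
exists (i.1, i.2, j.1, j.2) => //.
rewrite asboolT; first by split.
by apply: subset_trans AB => -[u v] [/= /iA ? /jB].
Qed.

Section lebesgue_circle.
Context {R : realType}.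

(* [lebesgue_measure] lives on [measurableTypeR R], whose display differs from
   the one attached to [R] itself. *)
Definition unit_lebesgue : set (measurableTypeR R) -> \bar R :=
  mrestr lebesgue_measure (measurable_itv `[(0 : R), 1[).
HB.instance Definition _ := Measure.on unit_lebesgue.

Let unit_lebesgue_setT : unit_lebesgue setT = 1%E.
Proof.
by rewrite /unit_lebesgue /mrestr setTI lebesgue_measure_itv/= lte01 sube0.
Qed.
HB.instance Definition _ :=
  Measure_isProbability.Build _ _ R unit_lebesgue unit_lebesgue_setT.

Definition lebesgue_circle : set (circle R) -> \bar R :=
  pushforward unit_lebesgue to_circle.

Let lebesgue_circle0 : lebesgue_circle set0 = 0%E.
Proof. by rewrite /lebesgue_circle /pushforward preimage_set0 measure0. Qed.

Let lebesgue_circle_ge0 A : (0 <= lebesgue_circle A)%E.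
Proof. by rewrite /lebesgue_circle /pushforward measure_ge0. Qed.

Let lebesgue_circle_sigma_additive : semi_sigma_additive lebesgue_circle.
Proof.
exact: (@measure_semi_sigma_additive _ _ _
  (measure_function_pushforward__canonical__measure_function_Measure
     unit_lebesgue measurable_to_circle)).
Qed.

HB.instance Definition _ := isMeasure.Build _ _ _ lebesgue_circle
  lebesgue_circle0 lebesgue_circle_ge0 lebesgue_circle_sigma_additive.

Let lebesgue_circle_setT : lebesgue_circle setT = 1%E.
Proof. exact: unit_lebesgue_setT. Qed.

HB.instance Definition _ :=
  Measure_isProbability.Build _ _ R lebesgue_circle lebesgue_circle_setT.

Definition lebesgue_torus : probability (circle R * circle R)%type R :=
  (lebesgue_circle \x lebesgue_circle)%E.

End lebesgue_circle.

Definition minimal (T : topologicalType) (f : T -> T) : Prop :=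
  forall x : T, dense (range (fun n => iter n f x)).

Definition measure_preserving d (T : measurableType d) (R : realType)
    (mu : probability T R) (f : T -> T) : Prop :=
  measurable_fun setT f /\
  forall A : set T, measurable A -> mu (f @^-1` A) = mu A.

Definition uniquely_ergodic (R : realType) d (T : measurableType d)
    (f : T -> T) : Prop :=
  exists2 mu : probability T R, measure_preserving mu f &
    forall nu : probability T R, measure_preserving nu f ->
      forall A : set T, measurable A -> nu A = mu A.

Section first_return.
Context {T : Type} (f : T -> T) (A : set T).

Definition return_domain : set T :=
  [set y | A y /\ exists n, (0 < n)%N /\ A (iter n f y)].

(* [xget] returns the minimum when there is one, and the junk value 0
   otherwise. *)
Definition return_time (y : T) : nat :=
  xget 0%N [set n | [/\ (0 < n)%N, A (iter n f y) &
    forall m, (0 < m)%N -> A (iter m f y) -> (n <= m)%N]].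

Definition first_return (y : T) : T := iter (return_time y) f y.

End first_return.

Definition full_invariant d (T : measurableType d) (R : realType)
    (mu : probability T R) (D : set T) (f : T -> T) (X : set T) : Prop :=
  [/\ measurable X, X `<=` D, mu (~` X) = 0%E & set_fun X X f].

(* [f] and [g] matter only on [D] and [E]: outside of these sets they may take
   junk values, as [first_return] does. *)
Definition conjugate_mod0 d d' (T : measurableType d) (T' : measurableType d')
    (R : realType)
    (mu : probability T R) (D : set T) (f : T -> T)
    (nu : probability T' R) (E : set T') (g : T' -> T') : Prop :=
  exists (X : set T) (Y : set T') (h : T -> T') (k : T' -> T),
    [/\ full_invariant mu D f X /\ full_invariant nu E g Y,
        set_fun X Y h /\ set_fun Y X k,
        (forall x, X x -> k (h x) = x) /\ (forall y, Y y -> h (k y) = y),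
        measurable_fun X h /\ measurable_fun Y k &
        (forall B, measurable B -> mu (X `&` h @^-1` B) = nu B) /\
        (forall x, X x -> h (f x) = g (h x))].

Definition self_induced d (T : measurableType d) (R : realType)
    (mu : probability T R) (f : T -> T) : Prop :=
  measure_preserving mu f /\
  exists (A : set T) (mA : measurable A),
    (0 < mu A < mu setT)%E /\
    conjugate_mod0 mu setT f
      (mnormalize (mrestr mu mA) mu) (return_domain f A) (first_return f A).

Definition golden (R : realType) : R := (1 + Num.sqrt 5) / 2.

Definition golden_skew (R : realType) (p : circle R * circle R) :
    circle R * circle R :=
  (p.1 + to_circle (1 / golden R ^+ 2),
   p.2 + p.1 - to_circle (1 / (2 * golden R ^+ 3))).

(* Main.v *)
Require Import Defs.
From mathcomp Require Import all_boot all_order all_algebra.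
From mathcomp Require Import generic_quotient ring_quotient.
From mathcomp Require Import all_classical all_reals all_analysis.
From mathcomp Require Import measurable_realfun ring lra.

Set Implicit Arguments.
Unset Strict Implicit.
Unset Printing Implicit Defensive.

Import Order.TTheory GRing.Theory Num.Theory.
Import numFieldNormedType.Exports.

Local Open Scope classical_set_scope.
Local Open Scope ring_scope.

(** The map is the skew translation T (y, z) = (y + al, z + y - be) with
    al = 1 / phi^2 = 2 - phi irrational and be = phi - 3 / 2.

    Self-induction.  The rotation by al = 1 - 1 / phi, induced on an interval
    of length 1 / phi, exchanges two intervals, with return times 1 and 2;
    rescaled by phi, it is the inverse of the original rotation.  So
    y = (1 - u) / phi conjugates the base rotation with the base of the first
    return map to the strip {0 < y <= 1 / phi}.  In the fibres, the conjugacy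
    has the form z |-> G y - z, where G must solve a cohomological equation;
    comparing coefficients on the two intervals shows that a quadratic
    polynomial does ([cobound], [into_strip_conj]).  The conjugacy multiplies
    the base measure by 1 / phi and acts on each fibre by a reflection; by
    uniqueness of product measures it therefore carries Haar measure to the
    normalized restriction ([lebesgue_torus_into_strip]).

    Unique ergodicity and minimality hold for every irrational al, by one
    spectral argument.  Let a mean be a positive, normalized, T-invariant
    linear functional on trigonometric polynomials.  Nontrivial characters of y
    alone are eigenfunctions of T with eigenvalue different from 1, so a mean
    kills them.  If chi also involves z, then the chi o T^n are orthogonal for the mean,
    since chi o T^i times the conjugate of chi o T^j is a nontrivial character
    of y alone; by Cauchy-Schwarz the common value l of the mean on them
    satisfies |l|^2 <= 1 / N for every N, hence l = 0 ([mean_wave]).  So there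
    is a single mean ([eq_mean]).
    - The integral against an invariant probability is a mean, and integrals
      of trigonometric polynomials determine a probability
      ([eq_trig_integral]): this is unique ergodicity.
    - Limits of Birkhoff averages along an ultrafilter are a mean too.  If an
      orbit missed a basic open set, the trigonometric polynomials
      approximating the indicator of this set would have small averages along
      the orbit, while their integrals tend to its positive measure: this is
      minimality.

    Everything is done with real cosines of arbitrary phase instead of complex
    exponentials. *)

(** * The fundamental domain of the circle *)

Section circle_angle.
Context {R : realType}.
Implicit Types (x y : R) (c : circle R).

Lemma to_circleD x y : to_circle (x + y) = to_circle x + to_circle y.
Proof. exact: (raddfD (\pi_(circle R)%qT)). Qed.

Lemma to_circleN x : to_circle (- x) = - to_circle x.
Proof. exact: (raddfN (\pi_(circle R)%qT)). Qed.

Lemma to_circleB x y : to_circle (x - y) = to_circle x - to_circle y.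
Proof. by rewrite to_circleD to_circleN. Qed.

Lemma to_circle_eqP x y :
  (exists m : int, x = y + m%:~R) <-> to_circle x = to_circle y.
Proof.
split=> [[m ->]|/eqP].
  apply/eqP; rewrite /to_circle -Quotient.idealrBE addrAC subrr add0r.
  exact: intr_int.
rewrite /to_circle -Quotient.idealrBE => /intrP[m xym].
by exists m; rewrite -xym addrC subrK.
Qed.

Lemma to_circleDz x (m : int) : to_circle (x + m%:~R) = to_circle x.
Proof. by apply/to_circle_eqP; exists m. Qed.

(** The representative in [0, 1).  The one given by [repr] is arbitrary, hence
    of no use for measurability or for describing intervals. *)
Definition angle c : R := repr c - (Num.floor (repr c))%:~R.

Lemma angleK c : to_circle (angle c) = c.
Proof. by rewrite /angle -mulrNz to_circleDz; exact: reprK. Qed.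

Lemma angle_itv c : 0 <= angle c < 1.
Proof.
rewrite /angle subr_ge0 ltrBlDl Num.Theory.floor_le /=.
by have := floorD1_gt (repr c); rewrite intrD.
Qed.

Lemma angle_ge0 c : 0 <= angle c. Proof. by have /andP[] := angle_itv c. Qed.

Lemma angle_lt1 c : angle c < 1. Proof. by have /andP[] := angle_itv c. Qed.

Lemma to_circleK x : 0 <= x < 1 -> angle (to_circle x) = x.
Proof.
move=> /andP[x0 x1]; have /to_circle_eqP[m] := angleK (to_circle x).
have /andP[f0 f1] := angle_itv (to_circle x) => fxm.
suff m0 : m = 0 by rewrite fxm m0 addr0.
have mE : m%:~R = angle (to_circle x) - x by rewrite fxm; ring.
apply/eqP; rewrite eq_le; apply/andP; split; rewrite -ltzD1 -(ltr_int R) intrD ?mE; lra.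
Qed.

(** Although [angle] jumps at 0, its superlevel sets are images of open
    intervals of the line. *)
Lemma measurable_angle : measurable_fun setT (angle : circle R -> R).
Proof.
apply: (@measurability _ _ _ _ setT _ (@RGenOInfty.G R)).
  exact: RGenOInfty.measurableE.
move=> _ [_ [x ->] <-]; rewrite setTI.
have [x0|x0] := ltP x 0.
  rewrite (_ : _ @^-1` _ = setT)//; apply/seteqP; split => // c _ /=.
  by rewrite in_itv /= andbT (lt_le_trans x0)// angle_ge0.
suff -> : (angle : circle R -> R) @^-1` `]x, +oo[ = to_circle @` `]x, 1[.
  by apply: sub_sigma_algebra; apply: open_to_circle; exact: interval_open.
apply/seteqP; split => [c /=|_ [y /= + <-]].
  rewrite in_itv /= andbT => xc; exists (angle c); last exact: angleK.
  by rewrite /= in_itv /= xc angle_lt1.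
rewrite !in_itv /= andbT => /andP[xy y1].
by rewrite to_circleK// y1 (le_trans x0 (ltW xy)).
Qed.

End circle_angle.

(** * Trigonometric polynomials on the torus *)

Section cos_period.
Context {R : realType}.
Implicit Types x y : R.

Lemma cosD2piz x (m : int) : cos (x + 2 * pi * m%:~R) = cos x.
Proof.
have cosDn y (n : nat) : cos (y + 2 * pi * n%:R) = cos y.
  rewrite -(periodicn (@cosD2pi R) n y).
  by rewrite -[in RHS]mulr_natr -[in RHS](mulr_natl pi 2).
case: m => n; first exact: cosDn.
by rewrite NegzE mulrNz mulrN -(cosDn _ n.+1) subrK.
Qed.

Lemma cos2pi_eq1 x : cos (2 * pi * x) = 1 -> exists m : int, x = m%:~R.
Proof.
pose m := Num.floor x; pose d := x - m%:~R.
have d0 : 0 <= d by rewrite subr_ge0 Num.Theory.floor_le.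
have d1 : d < 1 by rewrite ltrBlDl; have := floorD1_gt x; rewrite intrD.
have -> : 2 * pi * x = 2 * pi * d + 2 * pi * m%:~R by rewrite /d; ring.
rewrite cosD2piz => cd1.
have sd0 : sin (pi * d) = 0.
  apply/eqP; rewrite -sqrf_eq0 sin2cos2.
  have : cos (pi * d *+ 2) = 1.
    by rewrite -[RHS]cd1; congr cos; rewrite -mulr_natl mulrA.
  by rewrite cos_mulr2n -mulr_natl => ?; apply/eqP; lra.
exists m; apply/eqP; rewrite -subr_eq0 -/d eq_le d0 andbT leNgt.
apply/negP => dgt0.
have : 0 < sin (pi * d).
  by apply: sin_gt0_pi; rewrite mulr_gt0 ?pi_gt0//= gtr_pMr ?pi_gt0.
by rewrite sd0 ltxx.
Qed.

End cos_period.

Section trigonometric.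
Context {R : realType}.
Local Notation torus := (circle R * circle R)%type.
Implicit Types (a b : int) (s t x y : R) (p : torus) (F G : torus -> R).

(** The real part of the character of frequency (a, b), rotated by the phase
    t; letting t vary also covers the imaginary part. *)
Definition wave a b t p : R :=
  cos (2 * pi * (a%:~R * angle p.1 + b%:~R * angle p.2) + t).

Lemma waveE a b t x y : wave a b t (to_circle x, to_circle y) =
  cos (2 * pi * (a%:~R * x + b%:~R * y) + t).
Proof.
rewrite /wave /=.
have /to_circle_eqP[m ->] : to_circle (angle (to_circle x)) = to_circle x.
  exact: angleK.
have /to_circle_eqP[n ->] : to_circle (angle (to_circle y)) = to_circle y.
  exact: angleK.
rewrite -[RHS](cosD2piz _ (a * m + b * n)) intrD !intrM; congr cos; ring.
Qed.

(** Product-to-sum, which makes trigonometric polynomials an algebra. *)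
Lemma waveM a b s a' b' t p : wave a b s p * wave a' b' t p =
  1 / 2 * wave (a + a') (b + b') (s + t) p +
  1 / 2 * wave (a - a') (b - b') (s - t) p.
Proof.
rewrite /wave !intrD !mulrNz.
set u := 2 * pi * (a%:~R * angle p.1 + b%:~R * angle p.2) + s.
set v := 2 * pi * (a'%:~R * angle p.1 + b'%:~R * angle p.2) + t.
have -> : 2 * pi * ((a%:~R + a'%:~R) * angle p.1 + (b%:~R + b'%:~R) * angle p.2)
   + (s + t) = u + v by rewrite /u /v; ring.
have -> : 2 * pi * ((a%:~R - a'%:~R) * angle p.1 + (b%:~R - b'%:~R) * angle p.2)
   + (s - t) = u - v by rewrite /u /v; ring.
by rewrite (cosB u v) (cosD u v); field.
Qed.

Inductive trig_poly : (torus -> R) -> Prop :=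
| trig_wave a b t : trig_poly (wave a b t)
| trigD F G : trig_poly F -> trig_poly G -> trig_poly (fun p => F p + G p)
| trigZ (c : R) F : trig_poly F -> trig_poly (fun p => c * F p).

Lemma wave00 t p : wave 0 0 t p = cos t.
Proof. by rewrite /wave !mul0r addr0 mulr0 add0r. Qed.

Lemma trig_cst (c : R) : trig_poly (fun=> c).
Proof.
rewrite (_ : (fun=> c) = fun p => c * wave 0 0 0 p).
  exact/trigZ/trig_wave.
by apply/funext => p; rewrite wave00 cos0 mulr1.
Qed.

Lemma trigB F G : trig_poly F -> trig_poly G -> trig_poly (fun p => F p - G p).
Proof.
move=> tF tG; rewrite (_ : (fun p => _) = fun p => F p + (-1) * G p).
  exact/trigD/trigZ.
by apply/funext => p; rewrite mulN1r.
Qed.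

Lemma trigM F G : trig_poly F -> trig_poly G -> trig_poly (fun p => F p * G p).
Proof.
move=> tF; elim: tF G => {F} [a b s|F F' _ ihF _ ihF'|c F _ ihF] G tG.
- elim: tG => {G} [a' b' t|G G' _ ihG _ ihG'|c G _ ihG].
  + under eq_fun do rewrite waveM.
    by apply: trigD; apply/trigZ/trig_wave.
  + under eq_fun do rewrite mulrDr.
    exact: trigD.
  + under eq_fun do rewrite mulrCA.
    exact: trigZ.
- under eq_fun do rewrite mulrDl.
  by apply: trigD; [exact: ihF|exact: ihF'].
- under eq_fun do rewrite -mulrA.
  by apply: trigZ; exact: ihF.
Qed.

Lemma trigX F n : trig_poly F -> trig_poly (fun p => F p ^+ n).
Proof.
move=> tF; elim: n => [|n ih]; first exact: trig_cst.
by under eq_fun do rewrite exprS; exact: trigM.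
Qed.

Lemma trig_bounded F : trig_poly F -> exists M, forall p, `|F p| <= M.
Proof.
elim=> {F} [a b t|F G _ [M FM] _ [N GN]|c F _ [M FM]].
- by exists 1 => p; exact: cos_max.
- by exists (M + N) => p; rewrite (le_trans (ler_normD _ _))// lerD.
- by exists (`|c| * M) => p; rewrite normrM ler_wpM2l.
Qed.

Lemma measurable_trig F : trig_poly F -> measurable_fun setT F.
Proof.
elim=> {F} [a b t|F G _ mF _ mG|c F _ mF].
- apply: measurableT_comp.
    by apply: continuous_measurable_fun; exact: continuous_cos.
  apply: measurable_funD => //; apply: measurable_funM => //.
  apply: measurable_funD; apply: measurable_funM => //.
    exact: measurableT_comp measurable_angle measurable_fst.
  exact: measurableT_comp measurable_angle measurable_snd.
- exact: measurable_funD.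
- exact: measurable_funM.
Qed.

(** * Invariant means annihilate the nontrivial characters *)

Definition skew_shift (al be : R) p : torus :=
  (p.1 + to_circle al, p.2 + p.1 - to_circle be).

(** Composition with the map sends characters to characters, up to a phase. *)
Lemma wave_skew al be a b t p : wave a b t (skew_shift al be p) =
  wave (a + b) b (t + 2 * pi * (a%:~R * al - b%:~R * be)) p.
Proof.
case: p => y z; rewrite -(angleK y) -(angleK z) /skew_shift /=.
rewrite -!to_circleD -to_circleB !waveE intrD; congr cos; ring.
Qed.

Lemma trig_skew al be F : trig_poly F -> trig_poly (F \o skew_shift al be).
Proof.
elim=> {F} [a b t|F G _ tF _ tG|c F _ tF].
- by rewrite /comp; under eq_fun do rewrite wave_skew; exact: trig_wave.
- exact: (trigD tF tG).
- exact: (trigZ c tF).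
Qed.

(** The common abstraction of integration against an invariant measure and of
    limits of averages along an orbit. *)
Definition trig_mean (T : torus -> torus) (L : (torus -> R) -> R) : Prop :=
  [/\ L (fun=> 1) = 1,
      forall F G, trig_poly F -> trig_poly G -> L (fun p => F p + G p) = L F + L G,
      forall c F, trig_poly F -> L (fun p => c * F p) = c * L F,
      forall F, trig_poly F -> (forall p, 0 <= F p) -> 0 <= L F &
      forall F, trig_poly F -> L (F \o T) = L F].

Section mean.
Variables (al be : R) (L : (torus -> R) -> R).
Hypothesis al_irr : forall m n : int, m != 0 -> m%:~R * al != n%:~R.
Hypothesis Lmean : trig_mean (skew_shift al be) L.

Let LD F G : trig_poly F -> trig_poly G -> L (fun p => F p + G p) = L F + L G.
Proof. by have [_ + _ _ _] := Lmean; exact. Qed.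

Let LZ c F : trig_poly F -> L (fun p => c * F p) = c * L F.
Proof. by have [_ _ + _ _] := Lmean; exact. Qed.

Let L_ge0 F : trig_poly F -> (forall p, 0 <= F p) -> 0 <= L F.
Proof. by have [_ _ _ + _] := Lmean; exact. Qed.

Let LT F : trig_poly F -> L (F \o skew_shift al be) = L F.
Proof. by have [_ _ _ _] := Lmean; exact. Qed.

Lemma mean_cst c : L (fun=> c) = c.
Proof.
have [L1 _ _ _ _] := Lmean.
by have := LZ c (trig_cst 1); rewrite L1 !mulr1.
Qed.

Lemma mean_sum n (F : 'I_n -> torus -> R) : (forall i, trig_poly (F i)) ->
  trig_poly (fun p => \sum_(i < n) F i p) /\
  L (fun p => \sum_(i < n) F i p) = \sum_(i < n) L (F i).
Proof.
elim: n F => [|n ih] F tF.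
  under eq_fun do rewrite big_ord0.
  by split; [exact: trig_cst|rewrite mean_cst big_ord0].
have [t1 L1] := ih _ (fun i => tF (widen_ord (leqnSn n) i)).
under eq_fun do rewrite big_ord_recr /=.
by split; [exact: trigD|rewrite LD// L1 big_ord_recr].
Qed.

(** A nontrivial character of y alone is an eigenfunction with eigenvalue
    different from 1, by irrationality.  In real form: moving the phase by d does
    not change the mean m, while the waves of phases t + d and t - d add up to
    2 cos d times the wave of phase t, so that 2 m = 2 cos d m. *)
Lemma mean_wave_base a t : a != 0 -> L (wave a 0 t) = 0.
Proof.
move=> a0; pose d := 2 * pi * (a%:~R * al).
have Ld s : L (wave a 0 (s + d)) = L (wave a 0 s).
  rewrite -[RHS]LT; last exact: trig_wave.
  congr L; apply/funext => p /=; rewrite wave_skew addr0.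
  by congr wave; rewrite /d mul0r subr0.
have : L (wave a 0 (t + d)) + L (wave a 0 (t - d)) = 2 * cos d * L (wave a 0 t).
  rewrite -LD; [|exact: trig_wave..]; rewrite -LZ; last exact: trig_wave.
  congr L; apply/funext => p; rewrite /wave !addrA cosD cosB; ring.
rewrite Ld -(Ld (t - d)) subrK => E.
have : (1 - cos d) * L (wave a 0 t) = 0.
  by move: E; set l := L _; move=> E; lra.
move/eqP; rewrite mulf_eq0 => /orP[|/eqP//].
rewrite subr_eq0 eq_sym => /eqP/cos2pi_eq1[m E'].
by have := al_irr m a0; rewrite E' eqxx.
Qed.

Lemma wave_iter n a b : exists c : R, forall t p,
  wave a b t (iter n (skew_shift al be) p) = wave (a + n%:Z * b) b (t + c) p.
Proof.
elim: n a => [|n ih] a.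
  by exists 0 => t p; rewrite /= mul0r !addr0.
have [c cP] := ih (a + b).
exists (c + 2 * pi * (a%:~R * al - b%:~R * be)) => t p.
rewrite iterS wave_skew cP; congr wave; last by ring.
by rewrite intS; ring.
Qed.

(** The translates of a character that involves z are orthogonal for the mean,
    since the products of one with the conjugate of another are nontrivial
    characters of y alone.  The mean of the squared modulus of the sum of n of
    them is thus n, and positivity bounds the square of the common mean by
    1 / n. *)
Lemma mean_wave a b t : (a != 0) || (b != 0) -> L (wave a b t) = 0.
Proof.
have [-> |b0 _] := eqVneq b 0; first by rewrite orbF; exact: mean_wave_base.
set l := L _.
have [c cP] : exists c : nat -> R, forall n t p,
    wave a b t (iter n (skew_shift al be) p) = wave (a + n%:Z * b) b (t + c n) p.
  have /choice[c cP] := fun n => wave_iter n a b.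
  by exists c => n; exact: cP.
pose w n s := wave (a + n%:Z * b) b (s + c n).
have tw n s : trig_poly (w n s) by exact: trig_wave.
have Lw n : L (w n t) = l.
  rewrite (_ : w n t = wave a b t \o iter n (skew_shift al be)); last first.
    by apply/funext => p /=; rewrite cP.
  elim: n => [|n ih]; first by [].
  rewrite (_ : _ \o _ = (wave a b t \o iter n (skew_shift al be)) \o skew_shift al be).
    rewrite LT// /comp; under eq_fun do rewrite cP; exact: tw.
  by apply/funext => p /=; rewrite -iterSr.
(* Phase t - pi / 2 turns the cosines into the matching sines. *)
pose s' := t - pi / 2.
have corr i j p : w i t p * w j t p + w i s' p * w j s' p =
    wave ((i%:Z - j%:Z) * b) 0 (c i - c j) p.
  pose ph k := 2 * pi * ((a + k%:Z * b)%:~R * angle p.1 + b%:~R * angle p.2)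
               + (t + c k).
  have w'E k : w k s' p = sin (ph k).
    by rewrite -cosBpihalf /w /wave /s' /ph; congr cos; ring.
  rewrite !w'E (_ : w i t p = cos (ph i))// (_ : w j t p = cos (ph j))// -cosB.
  by rewrite /wave /ph; congr cos; rewrite !(intrD, intrM, mulrNz); ring.
have Lsq N : l ^+ 2 * N.+1%:R <= 1.
  have [tS LS] := mean_sum (fun i : 'I_N.+1 => tw i t).
  have [tS' _] := mean_sum (fun i : 'I_N.+1 => tw i s').
  pose S p := \sum_(i < N.+1) w i t p; pose S' p := \sum_(i < N.+1) w i s' p.
  have LSE : L S = N.+1%:R * l.
    by rewrite LS; under eq_bigr do rewrite Lw; rewrite sumr_const card_ord mulr_natl.
  have E2 p : S p ^+ 2 + S' p ^+ 2 = \sum_(i < N.+1) \sum_(j < N.+1)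
      wave ((i%:Z - j%:Z) * b) 0 (c i - c j) p.
    rewrite !expr2 /S /S' !mulr_suml -big_split; apply: eq_bigr => i _ /=.
    rewrite !mulr_sumr -big_split; apply: eq_bigr => j _ /=; exact: corr.
  have L2 : L (fun p => S p ^+ 2 + S' p ^+ 2) = N.+1%:R.
    under eq_fun do rewrite E2.
    have tin (i : 'I_N.+1) := mean_sum (fun j : 'I_N.+1 =>
       trig_wave ((i%:Z - j%:Z) * b) 0 (c i - c j)).
    have [_ ->] := mean_sum (fun i => (tin i).1).
    transitivity (\sum_(i < N.+1) (1 : R)); last by rewrite sumr_const card_ord.
    apply: eq_bigr => i _; rewrite (tin i).2 (bigD1 i)//= big1 ?addr0.
      rewrite !subrr mul0r -[RHS]mean_cst; congr L.
      by apply/funext => p; rewrite wave00 cos0.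
    move=> j ji; apply: mean_wave_base.
    rewrite mulf_neq0// subr_eq0; apply: contra ji => /eqP[ij].
    by apply/eqP/val_inj.
  (* Positivity applied to (S - N l)^2 + S'^2, with N the number of terms. *)
  have : 0 <= L (fun p => S p ^+ 2 + S' p ^+ 2 + (- 2 * l * N.+1%:R) * S p +
                          (l * N.+1%:R) ^+ 2).
    apply: L_ge0 => [|p].
      apply: trigD; last exact: trig_cst.
      apply: trigD; last exact: trigZ.
      by apply: trigD; exact: trigX.
    have := sqr_ge0 (S p - l * N.+1%:R); have := sqr_ge0 (S' p).
    set x := S p; set y := S' p; nra.
  rewrite LD; [|apply: trigD; [by apply: trigD; exact: trigX|exact: trigZ]
               |exact: trig_cst].
  rewrite LD; [|by apply: trigD; exact: trigX|exact: trigZ].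
  rewrite L2 LZ// LSE mean_cst.
  have : 0 < N.+1%:R :> R by [].
  set M := N.+1%:R => M0 H.
  have : 0 <= M * (1 - l ^+ 2 * M) by move: H; rewrite -/M; nra.
  by rewrite pmulr_rge0// subr_ge0.
apply/eqP; rewrite -sqrf_eq0 eq_le sqr_ge0 andbT leNgt; apply/negP => l0.
have [N NP] : exists N : nat, 1 < l ^+ 2 * N.+1%:R.
  exists (Num.truncn (l ^- 2)).
  by rewrite -ltr_pdivrMl// mulr1; exact: truncnS_gt.
by have := lt_le_trans NP (Lsq N); rewrite ltxx.
Qed.

End mean.

(** Both means pick out the constant term. *)
Lemma eq_mean al be L L' :
  (forall m n : int, m != 0 -> m%:~R * al != n%:~R) ->
  trig_mean (skew_shift al be) L -> trig_mean (skew_shift al be) L' ->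
  forall F, trig_poly F -> L F = L' F.
Proof.
move=> irr mL mL' F.
elim=> {F} [a b t|F G tF EF tG EG|c F tF EF].
- have [ab|/norP[]] := boolP ((a != 0) || (b != 0)).
    by rewrite (mean_wave irr mL)// (mean_wave irr mL').
  rewrite !negbK => /eqP-> /eqP->; rewrite (_ : wave 0 0 t = fun=> cos t).
    by rewrite (mean_cst mL) (mean_cst mL').
  by apply/funext => p; rewrite wave00.
- by case: mL mL' => [_ -> // _ _ _] [_ -> // _ _ _]; rewrite EF EG.
- by case: mL mL' => [_ _ -> // _ _] [_ _ -> // _ _]; rewrite EF.
Qed.

End trigonometric.

(** * Trigonometric polynomials determine a probability on the torus *)

Section step_polynomial.
Context {R : realType}.
Implicit Types (x w t : R) (n M : nat).

Lemma expr_bernoulli_le w n : 0 <= w <= 1 -> w ^+ n * (1 + n%:R * (1 - w)) <= 1.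
Proof.
move=> /andP[w0 w1]; elim: n => [|n ih]; first by rewrite expr0 mul0r addr0 mulr1.
apply: le_trans ih; rewrite exprSr -mulrA ler_wpM2l ?exprn_ge0//.
rewrite -natr1 -subr_ge0.
suff -> : 1 + n%:R * (1 - w) - w * (1 + (n%:R + 1) * (1 - w)) =
    (n%:R + 1) * (1 - w) ^+ 2 by rewrite mulr_ge0 ?sqr_ge0// addr_ge0.
ring.
Qed.

Lemma expr_onem_ge t n : 0 <= t <= 1 -> 1 - n%:R * t <= (1 - t) ^+ n.
Proof.
move=> /andP[t0 t1]; elim: n => [|n ih]; first by rewrite mul0r subr0.
have /andP[e0 e1] : 0 <= (1 - t) ^+ n <= 1.
  by rewrite exprn_ge0 ?exprn_ile1//=; lra.
rewrite exprSr -natr1; move: ih e0 e1; set u := n%:R; set e := _ ^+ n; nra.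
Qed.

Lemma cvg_natmul_expr w : 0 <= w < 1 -> (n%:R * w ^+ n) @[n --> \oo] --> (0 : R).
Proof.
move=> /andP[w0 w1]; pose v := (1 + w) / 2.
have v01 : 0 <= v <= 1 by rewrite /v; lra.
have vlt1 : v < 1 by rewrite /v; lra.
have wv2 : w <= v ^+ 2 by rewrite /v; have := sqr_ge0 (1 - w); nra.
apply: (@squeeze_cvgr _ _ _ _ (fun=> 0) (geometric (1 - v)^-1 v)).
- apply: nearW => n; rewrite mulr_ge0 ?exprn_ge0//=.
  apply: (@le_trans _ _ (n%:R * (v ^+ n * v ^+ n))).
    rewrite ler_wpM2l// -exprD addnn -mul2n exprM.
    by rewrite lerXn2r// nnegrE// sqr_ge0.
  rewrite mulrA ler_wpM2r ?exprn_ge0//; first by lra.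
  rewrite -(ler_pM2r (_ : 0 < 1 - v)) ?subr_gt0// mulVf ?subr_eq0 ?gt_eqF//.
  apply: le_trans (expr_bernoulli_le n v01).
  rewrite -subr_ge0 (_ : _ - _ = v ^+ n); last by ring.
  by rewrite exprn_ge0//; lra.
- exact: cvg_cst.
- by apply: cvg_geometric; rewrite ger0_norm//; lra.
Qed.

(** Polynomials that converge on [0, 1] to the indicator of [0, 1/2).  The
    exponent is chosen between the two regimes: n (2 x)^n tends to 0 below 1/2
    and is at least n from 1/2 on, which gives the uniform bound of
    [step_small]. *)
Definition step n x : R := (1 - x ^+ n) ^+ (n * 2 ^ n).

Lemma step_itv n x : 0 <= x <= 1 -> 0 <= step n x <= 1.
Proof.
move=> /andP[x0 x1].
have [h0 h1] : 0 <= x ^+ n /\ x ^+ n <= 1 by rewrite exprn_ge0 ?exprn_ile1.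
by rewrite /step exprn_ge0 ?exprn_ile1//; lra.
Qed.

Lemma step_small n x : 1 / 2 <= x <= 1 -> step n x <= n.+1%:R^-1.
Proof.
move=> /andP[x0 x1].
have w01 : 0 <= 1 - x ^+ n <= 1.
  have [h0 h1] : 0 <= x ^+ n /\ x ^+ n <= 1.
    by rewrite exprn_ge0 ?exprn_ile1//; lra.
  lra.
have := expr_bernoulli_le (n * 2 ^ n) w01; rewrite -/(step n x) subKr.
have [s0 _] : 0 <= step n x /\ step n x <= 1.
  by apply/andP/step_itv; lra.
move=> H; rewrite -[leRHS]mul1r ler_pdivlMr//; apply: le_trans H.
rewrite ler_wpM2l// -natr1 addrC lerD2l.
rewrite natrM natrX -mulrA -exprMn ler_peMr// exprn_ege1//; lra.
Qed.

Lemma step_cvg x : 0 <= x < 1 / 2 -> step n x @[n --> \oo] --> (1 : R).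
Proof.
move=> /andP[x0 x1].
apply: (@squeeze_cvgr _ _ _ _ (fun n => 1 - n%:R * (2 * x) ^+ n) (fun=> 1)).
- apply: nearW => n; apply/andP; split.
    rewrite /step exprMn mulrA -natrX -natrM; apply: expr_onem_ge.
    by rewrite exprn_ge0 ?exprn_ile1//; lra.
  by have /andP[] : 0 <= step n x <= 1 by apply: step_itv; lra.
- rewrite -[X in _ --> X]subr0; apply: cvgB; first exact: cvg_cst.
  by apply: cvg_natmul_expr; lra.
- exact: cvg_cst.
Qed.

End step_polynomial.

Section trig_approx.
Context {R : realType}.
Local Notation torus := (circle R * circle R)%type.
Implicit Types (s c e x : R) (y z : circle R) (A B U : set torus).

(** The uniform bound outside A, stronger than pointwise convergence to 0, is
    what a bound along an orbit that avoids A requires. *)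
Definition trig_approx A : Prop := exists F : nat -> torus -> R,
  [/\ forall n, trig_poly (F n), forall n p, 0 <= F n p <= 1,
      forall n p, ~ A p -> F n p <= n.+1%:R^-1 &
      forall p, A p -> F n p @[n --> \oo] --> (1 : R)].

Lemma trig_approxI : setI_closed trig_approx.
Proof.
move=> A B [F [tF F01 F0 F1]] [G [tG G01 G0 G1]].
exists (fun n p => F n p * G n p); split.
- by move=> n; exact: trigM.
- move=> n p; have /andP[f0 f1] := F01 n p; have /andP[g0 g1] := G01 n p.
  by rewrite mulr_ge0//= mulr_ile1.
- move=> n p /not_andP[nA|nB].
    have /andP[f0 f1] := F01 n p; have /andP[g0 g1] := G01 n p.
    by rewrite (le_trans _ (F0 n p nA))// ler_piMr.
  have /andP[f0 f1] := F01 n p; have /andP[g0 g1] := G01 n p.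
  by rewrite (le_trans _ (G0 n p nB))// ler_piMl.
- by move=> p [Ap Bp]; rewrite -[1]mulr1; apply: cvgM; [exact: F1|exact: G1].
Qed.

Lemma trig_step n (F : torus -> R) : trig_poly F -> trig_poly (fun p => step n (F p)).
Proof. by move=> tF; apply: trigX; apply: trigB; [exact: trig_cst|exact: trigX]. Qed.

Lemma trig_approx_setT : trig_approx setT.
Proof.
exists (fun _ _ => 1); split => [n|n p|n p /(_ I)//|p _].
- exact: trig_cst.
- by rewrite ler01 lexx.
- exact: cvg_cst.
Qed.

(** Renormalize the wave affinely so that it takes values in [0, 1] and crosses
    1/2 exactly where it crosses c, then apply [step]. *)
Lemma trig_approx_gt a b t c : trig_approx [set p | c < wave a b t p].
Proof.
pose f p := 1 / 2 - (wave a b t p - c) / (2 * (1 + `|c|)) : R.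
have k0 : 0 < 1 + `|c| by rewrite ltr_pwDl.
have f01 p : 0 <= f p <= 1.
  suff : `|(wave a b t p - c) / (2 * (1 + `|c|))| <= 1 / 2.
    by rewrite ler_norml /f => /andP[? ?]; lra.
  rewrite normrM normfV (@gtr0_norm _ (2 * _)) ?mulr_gt0// ler_pdivrMr ?mulr_gt0//.
  rewrite mulrA div1r mulVf// mul1r (le_trans (ler_normB _ _))// lerD2r.
  exact: cos_max.
have fE p : (f p < 1 / 2) = (c < wave a b t p).
  rewrite /f ltrBlDl ltrDr pmulr_lgt0 ?invr_gt0 ?mulr_gt0//.
  by rewrite subr_gt0.
exists (fun n p => step n (f p)); split.
- move=> n; apply: trig_step; apply: trigB; first exact: trig_cst.
  by under eq_fun do rewrite mulrC; apply: trigZ; apply: trigB;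
    [exact: trig_wave|exact: trig_cst].
- by move=> n p; exact: step_itv.
- move=> n p /negP; rewrite -fE -leNgt => fp; apply: step_small.
  by rewrite fp; have /andP[] := f01 p.
- move=> p; rewrite /= -fE => fp; apply: step_cvg.
  by rewrite fp andbT; have /andP[] := f01 p.
Qed.

(** The open arc around s on which a cosine exceeds c. *)
Definition cap s c : set (circle R) :=
  [set y | c < cos (2 * pi * (angle y - s))].

Lemma cap_to_circle s c x : cap s c (to_circle x) = (c < cos (2 * pi * (x - s))).
Proof.
rewrite /cap /=; have /to_circle_eqP[m ->] := angleK (to_circle x).
by rewrite (_ : _ * _ = 2 * pi * (x - s) + 2 * pi * m%:~R) ?cosD2piz//; ring.
Qed.

Lemma open_cap s c : open (cap s c).
Proof.
rewrite circle_openE (_ : _ @^-1` _ =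
    (fun x => cos (2 * pi * (x - s))) @^-1` `]c, +oo[).
  apply: open_comp; last exact: interval_open.
  move=> x _; apply: continuous_comp; last exact: continuous_cos.
  by apply: cvgM; [exact: cvg_cst|apply: cvgB; [exact: cvg_id|exact: cvg_cst]].
apply/seteqP; split => x /=; rewrite in_itv/= andbT.
  by rewrite -[X in X -> _]/(cap s c _) cap_to_circle.
by rewrite -[X in _ -> X]/(cap s c _) cap_to_circle.
Qed.

(** The cosine decreases on [0, pi], so a large value of the cosine bounds the
    distance to s modulo 1. *)
Lemma cap_sub s e y : 0 <= e <= 1 -> cap s (cos (pi * e)) y ->
  exists2 d, `|d| < e / 2 & y = to_circle (s + d).
Proof.
move=> /andP[e0 e1]; rewrite -{1}(angleK y) cap_to_circle => ce.
pose m := Num.floor (angle y - s + 1 / 2); pose d := angle y - s - m%:~R.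
have d1 : - (1 / 2) <= d.
  by rewrite /d; have := Num.Theory.floor_le (angle y - s + 1 / 2); rewrite -/m; lra.
have d2 : d <= 1 / 2.
  by have := floorD1_gt (angle y - s + 1 / 2); rewrite -/m intrD /d; lra.
exists d; last first.
  rewrite (_ : s + d = angle y + (- m)%:~R) ?to_circleDz ?angleK//.
  by rewrite /d mulrNz; ring.
have dE : 2 * pi * (angle y - s) = 2 * pi * d + 2 * pi * m%:~R by rewrite /d; ring.
have pi0 := pi_gt0 R.
have nd : `|d| <= 1 / 2 by rewrite ler_norml d1.
move: ce; rewrite dE cosD2piz -(cos_norm (2 * pi * d)) ltr_cos.
- by rewrite normrM gtr0_norm ?mulr_gt0// => H; rewrite -(ltr_pM2l pi0); lra.
- by rewrite in_itv/= normr_ge0 normrM gtr0_norm ?mulr_gt0//; nra.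
- by rewrite in_itv/=; nra.
Qed.

Lemma nbhs_cap y (V : set (circle R)) : nbhs y V -> exists q : rat * rat,
  cap (ratr q.1) (ratr q.2) y /\ cap (ratr q.1) (ratr q.2) `<=` V.
Proof.
rewrite nbhsE => -[W [oW Wy] WV].
have : nbhs (angle y) (to_circle @^-1` W).
  by apply: open_nbhs_nbhs; split; [exact: oW|rewrite /= angleK].
move=> /nbhs_ballP[e0 /= e00 eW].
pose e := Num.min e0 1.
have e_gt0 : 0 < e by rewrite lt_min e00 ltr01.
have e1 : e <= 1 by rewrite ge_min lexx orbT.
have ee0 : e <= e0 by rewrite ge_min lexx.
have /rat_in_itvoo[s] : angle y < angle y + e / 2 by lra.
rewrite in_itv /= => /andP[s1 s2].
have pi0 := pi_gt0 R.
have /rat_in_itvoo[c] : cos (pi * e) < cos (2 * pi * (angle y - ratr s)).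
  rewrite -(cosN (2 * pi * _)) -mulrN opprB ltr_cos ?in_itv/=; [nra|nra|nra].
rewrite in_itv /= => /andP[c1 c2].
exists (s, c); split; first exact: c2.
move=> z /= cz; have : cap (ratr s) (cos (pi * e)) z by exact: lt_trans cz.
move=> /cap_sub[|d de ->]; first by rewrite ltW.
apply/WV/eW; rewrite /ball /= distrC ltr_distl; move: de; rewrite ltr_norml.
move=> /andP[]; lra.
Qed.

(** Rational parameters make this base of the topology countable, so that it
    also generates the Borel sets. *)
Definition box (q : rat * rat * (rat * rat)) : set torus :=
  cap (ratr q.1.1) (ratr q.1.2) `*` cap (ratr q.2.1) (ratr q.2.2).

Lemma trig_approx_box q : trig_approx (box q).
Proof.
rewrite (_ : box q =
  [set p | ratr q.1.2 < wave 1 0 (- (2 * pi * ratr q.1.1)) p] `&`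
  [set p | ratr q.2.2 < wave 0 1 (- (2 * pi * ratr q.2.1)) p]).
  by apply: trig_approxI; exact: trig_approx_gt.
rewrite /wave; apply/seteqP; split => -[y z] /=;
  rewrite !mul0r !mul1r addr0 add0r -!mulrBr; exact.
Qed.

Lemma open_box q : open (box q).
Proof.
rewrite openE => -[y z] [/= cy cz]; exists (cap (ratr q.1.1) (ratr q.1.2),
  cap (ratr q.2.1) (ratr q.2.2)) => //=.
by split; apply: open_nbhs_nbhs; split => //; exact: open_cap.
Qed.

Lemma nbhs_box p U : nbhs p U -> exists q, box q p /\ box q `<=` U.
Proof.
case: p => y z [[A B] [/= nA nB] ABU].
have [q [qy qA]] := nbhs_cap nA; have [r [rz rB]] := nbhs_cap nB.
exists (q, r); split => //; apply: subset_trans ABU => -[u v] [/= /qA ? /rB ?].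
by [].
Qed.

Lemma measurable_trig_approx : @measurable _ torus =
  <<s [set A | measurable A /\ trig_approx A] >>.
Proof.
rewrite eqEsubset; split; last first.
  by apply: smallest_sub; [exact: sigma_algebra_measurable|move=> A []].
rewrite [X in X `<=` _]measurable_torusE; apply: smallest_sub.
  exact: smallest_sigma_algebra.
move=> U oU.
pose V q := if `[< box q `<=` U >] then box q else set0.
have -> : U = \bigcup_q V q.
  apply/seteqP; split; last first.
    by move=> p [q _]; rewrite /V; case: asboolP => // /[apply].
  move=> p Up; have [q [qp qU]] := nbhs_box (open_nbhs_nbhs (conj oU Up)).
  by exists q => //; rewrite /V asboolT.
pose gT := g_sigma_algebraType [set A : set torus | measurable A /\ trig_approx A].
apply: (@countable_bigcupT_measurable _ gT); first exact: countableP.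
move=> q; rewrite /V; case: ifPn => // _; apply: sub_sigma_algebra; split.
  by rewrite measurable_torusE; apply: sub_sigma_algebra; exact: open_box.
exact: trig_approx_box.
Qed.

Lemma integrable_trig (nu : probability torus R) F : trig_poly F ->
  nu.-integrable setT (EFin \o F).
Proof.
move=> tF; apply: measurable_bounded_integrable => //.
- by rewrite ltey_eq fin_num_measure.
- exact: measurable_trig.
- have [M FM] := trig_bounded tF.
  exists M; split; first exact: num_real.
  by move=> N MN p _; exact: le_trans (FM p) (ltW MN).
Qed.

(** Dominated convergence; the sequence converges to the indicator of A. *)
Lemma trig_approx_integral (nu : probability torus R) A (F : nat -> torus -> R) :
  measurable A -> (forall n, trig_poly (F n)) -> (forall n p, 0 <= F n p <= 1) ->
  (forall n p, ~ A p -> F n p <= n.+1%:R^-1) ->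
  (forall p, A p -> F n p @[n --> \oo] --> (1 : R)) ->
  \int[nu]_p (F n p) @[n --> \oo] --> fine (nu A).
Proof.
move=> mA tF F01 F0 F1.
have [] := @dominated_convergence _ _ _ nu setT measurableT
  (fun n => EFin \o F n) (EFin \o \1_A) (cst 1%E).
- by move=> n; apply/measurable_EFinP; exact: measurable_trig.
- exact/measurable_EFinP/measurable_indic.
- apply: aeW => p _; apply/fine_cvgP; split; first exact: nearW.
  rewrite /= indicE; have [Ap|nAp] := pselect (A p).
    by rewrite mem_set//; exact: F1.
  rewrite memNset//.
  apply: (@squeeze_cvgr _ _ _ _ (fun=> 0) (@harmonic R)).
  + apply: nearW => n; have /andP[-> _] := F01 n p; exact: F0.
  + exact: cvg_cst.
  + exact: cvg_harmonic.
- exact: (integrable_trig nu (trig_cst 1)).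
- apply: aeW => p n _ /=; rewrite lee_fin.
  by have /andP[? ?] := F01 n p; rewrite ger0_norm.
- move=> _ _; rewrite integral_indic// setIT.
  rewrite -[X in _ --> X](fineK (fin_num_measure nu _ mA)).
  exact: fine_cvg.
Qed.

(** The sets approximable by trigonometric polynomials form a pi-system that
    generates the Borel sets. *)
Lemma eq_trig_integral (nu mu : probability torus R) :
  (forall F, trig_poly F -> \int[nu]_p F p = \int[mu]_p F p) ->
  forall A, measurable A -> nu A = mu A.
Proof.
move=> E A mA; apply: (measure_unique _ (fun=> setT) measurable_trig_approx) => //.
- move=> A1 A2 [m1 t1] [m2 t2]; split; first exact: measurableI.
  exact: trig_approxI.
- by move=> _; split => //; exact: trig_approx_setT.
- by rewrite bigcup_const.
- move=> B [mB [F [tF F01 F0 F1]]].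
  have cnu := trig_approx_integral (nu := nu) mB tF F01 F0 F1.
  have cmu := trig_approx_integral (nu := mu) mB tF F01 F0 F1.
  rewrite -[LHS]fineK ?fin_num_measure// -[RHS]fineK ?fin_num_measure//.
  have EF : (fun n => \int[nu]_p F n p) = (fun n => \int[mu]_p F n p).
    by apply/funext => n; exact: E.
  rewrite EF in cnu; congr EFin; exact: cvg_unique cnu cmu.
- by move=> _; rewrite ltey_eq fin_num_measure.
Qed.

End trig_approx.

(** * Invariant measures and orbits define means *)

Section skew_dynamics.
Context {R : realType}.
Local Notation torus := (circle R * circle R)%type.
Implicit Types (T : torus -> torus) (F : torus -> R) (x : torus).

Lemma trig_mean_integral al be (nu : probability torus R) :
  measure_preserving nu (skew_shift al be) ->
  trig_mean (skew_shift al be) (fun F => \int[nu]_p F p).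
Proof.
move=> [mT nuT]; split.
- rewrite (_ : (fun=> 1) = cst 1)// Rintegral_cst// mul1r.
  by have /= -> := probability_setT nu.
- by move=> F G tF tG; rewrite RintegralD//; exact: integrable_trig.
- by move=> c F tF; rewrite RintegralZl//; exact: integrable_trig.
- by move=> F tF F0; apply: Rintegral_ge0.
- move=> F tF; rewrite /Rintegral; congr fine.
  have -> : (\int[nu]_p (F p)%:E = \int[pushforward nu (skew_shift al be)]_p (F p)%:E)%E.
    by apply: eq_measure_integral => A mA _; exact/esym/nuT.
  rewrite integral_pushforward//.
  + by apply/measurable_EFinP; exact: measurable_trig.
  + by apply: (integrable_trig nu (F := F \o skew_shift al be)); exact: trig_skew.
Qed.

Definition birkhoff T x F (n : nat) : R :=
  n.+1%:R^-1 * \sum_(k < n.+1) F (iter k T x).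

Lemma birkhoff_le T x F (M : R) n : (forall p, `|F p| <= M) -> `|birkhoff T x F n| <= M.
Proof.
move=> FM; rewrite /birkhoff normrM normfV normr_nat ler_pdivrMl//.
rewrite mulr_natl (le_trans (ler_norm_sum _ _ _))//.
rewrite -[n.+1 in leRHS]card_ord -sumr_const ler_sum//.
Qed.

Lemma cvg_birkhoffT T x F : (exists M, forall p, `|F p| <= M) ->
  birkhoff T x (F \o T) n - birkhoff T x F n @[n --> \oo] --> (0 : R).
Proof.
move=> [M FM].
have E n : birkhoff T x (F \o T) n - birkhoff T x F n =
    n.+1%:R^-1 * (F (iter n.+1 T x) - F x).
  rewrite /birkhoff -mulrBr; congr (_ * _).
  rewrite big_ord_recr [X in _ - X]big_ord_recl /=.
  ring.
under eq_fun do rewrite E.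
apply/norm_cvg0P.
apply: (@squeeze_cvgr _ _ _ _ (fun=> 0) (fun n => n.+1%:R^-1 * (M + M))).
- apply: nearW => n; rewrite normr_ge0/= normrM normfV normr_nat ler_wpM2l//.
  by rewrite (le_trans (ler_normB _ _))// lerD.
- exact: cvg_cst.
- rewrite -[X in _ --> X](mul0r (M + M)); apply: cvgM; last exact: cvg_cst.
  exact: cvg_harmonic.
Qed.

(** Averages of a trigonometric polynomial along the orbit of x are bounded, so
    they converge along any free ultrafilter; the limit is invariant because
    the averages of F o T and of F differ by O(1 / n). *)
Lemma trig_mean_birkhoff al be x : exists2 L, trig_mean (skew_shift al be) L &
  forall F c, trig_poly F -> (forall n, F (iter n (skew_shift al be) x) <= c) -> L F <= c.
Proof.
have [U [UU sU]] := ultraFilterLemma (_ : ProperFilter (\oo : set_system nat)).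
pose T := skew_shift al be.
have PU : ProperFilter U by exact: ultra_proper.
have cvgU (u : nat -> R) M : (forall n, `|u n| <= M) -> cvg (u @ U).
  move=> uM.
  have [|l [_ clu]] := @segment_compact R (- M) M (u @ U) _.
    by apply: nearW => n /=; rewrite in_itv/= -ler_norml.
  apply/cvg_ex; exists l => N lN.
  have [//|nN] := in_ultra_setVsetC (u @^-1` N) UU.
  by have [r []] := clu (~` N) N nN lN.
pose L F := lim (birkhoff T x F n @[n --> U]).
have cvgL F : trig_poly F -> birkhoff T x F n @[n --> U] --> L F.
  move=> /trig_bounded[M FM]; apply: (cvgU _ M) => n; exact: birkhoff_le.
have LE F l : birkhoff T x F n @[n --> U] --> l -> L F = l.
  exact: cvg_lim.
exists L; last first.
  move=> F c tF Fc; apply: limr_le; first by apply: cvgP; exact: cvgL.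
  apply: nearW => n; rewrite /birkhoff ler_pdivrMl// mulr_natl.
  by rewrite -[n.+1 in leRHS]card_ord -sumr_const ler_sum.
split.
- apply: LE; apply: cvg_near_cst; apply: nearW => n.
  by rewrite /birkhoff sumr_const card_ord mulVf.
- move=> F G tF tG; apply: LE.
  rewrite (_ : birkhoff T x _ = fun n => birkhoff T x F n + birkhoff T x G n).
    exact: cvgD (cvgL F tF) (cvgL G tG).
  by apply/funext => n; rewrite /birkhoff big_split mulrDr.
- move=> c F tF; apply: LE.
  rewrite (_ : birkhoff T x _ = fun n => c * birkhoff T x F n).
    by apply: cvgM; [exact: cvg_cst|exact: cvgL].
  by apply/funext => n; rewrite /birkhoff -mulr_sumr mulrCA.
- move=> F tF F0; apply: limr_ge; first by apply: cvgP; exact: cvgL.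
  by apply: nearW => n; rewrite /birkhoff mulr_ge0// sumr_ge0.
- move=> F tF; apply: LE.
  rewrite (_ : birkhoff T x _ = fun n =>
     (birkhoff T x (F \o T) n - birkhoff T x F n) + birkhoff T x F n).
    rewrite -[X in _ --> X]add0r; apply: cvgD; last exact: cvgL.
    have := cvg_birkhoffT T x (trig_bounded tF).
    exact: cvg_trans (cvg_app _ sU).
  by apply/funext => n; rewrite subrK.
Qed.

End skew_dynamics.

(** * Haar measure on the circle *)

Section lebesgue_affine.
Context {R : realType}.
Local Notation leb := (@lebesgue_measure R).
Implicit Types (a b : R) (S : set R).

(** Both sides, multiplied by a, are measures of S that agree on intervals. *)
Lemma lebesgue_measure_affine_gt0 a b S : 0 < a -> measurable S ->
  leb ((fun x => a * x + b) @^-1` S) = (a^-1%:E * leb S)%E.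
Proof.
move=> a0 mS.
have mf : measurable_fun setT
    (fun x : measurableTypeR R => a * x + b : measurableTypeR R).
  by apply: measurable_funD => //; exact: measurable_funM.
have an : 0 <= a by exact: ltW.
have := @lebesgue_measure_unique R (mscale (NngNum an)
  (measure_function_pushforward__canonical__measure_function_Measure leb mf)) _ S mS.
rewrite /mscale/= /pushforward => ->.
  by rewrite muleA -EFinM mulVf ?gt_eqF// mul1e.
move=> _ [[u v] /= _ <-]; rewrite /mscale/= /pushforward.
rewrite (_ : _ @^-1` _ = `](u - b) / a, (v - b) / a]%classic).
  rewrite !lebesgue_measure_itv/= !lte_fin ltr_pM2r ?invr_gt0// ltrD2r.
  case: ifPn => _; last by rewrite mule0.
  by rewrite -!EFinD -EFinM; congr EFin; field; rewrite gt_eqF.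
apply/seteqP; split => x /=; rewrite !in_itv/= ltr_pdivrMr// ler_pdivlMr//;
  by rewrite ltrBlDr lerBrDr (mulrC x).
Qed.

Lemma lebesgue_measure_affine a b S : a != 0 -> measurable S ->
  leb ((fun x => a * x + b) @^-1` S) = (`|a|^-1%:E * leb S)%E.
Proof.
move=> a0 mS; have [agt0|alt0] : 0 < a \/ a < 0.
- by move: a0; rewrite neq_lt => /orP[]; auto.
- by rewrite lebesgue_measure_affine_gt0// gtr0_norm.
rewrite ltr0_norm// -(lebesgue_measure_affine_gt0 b) ?oppr_gt0//.
rewrite -lebesgue_measureN; last first.
  have mf : measurable_fun setT (fun x : R => a * x + b).
    by apply: measurable_funD => //; exact: measurable_funM.
  by have := mf measurableT S mS; rewrite setTI.
by congr (leb _); apply/seteqP; split => x /=; rewrite mulNr mulrN.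
Qed.

End lebesgue_affine.

Section circle_measure.
Context {R : realType}.
Local Notation leb := (@lebesgue_measure R).
Implicit Types (a b : R) (c y : circle R) (C W : set (circle R)).

Let measurable_preim C : measurable C -> measurable (to_circle @^-1` C : set R).
Proof. by move=> mC; rewrite -[X in measurable X]setTI; exact: measurable_to_circle. Qed.

Lemma measurable_circleB d (X : measurableType d) (f g : X -> circle R) :
  measurable_fun setT f -> measurable_fun setT g ->
  measurable_fun setT (fun x => f x - g x).
Proof.
move=> mf mg.
rewrite (_ : (fun x => _) = to_circle \o (fun x => angle (f x) - angle (g x))).
  apply: measurableT_comp; first exact: measurable_to_circle.
  by apply: measurable_funB; apply: measurableT_comp => //; exact: measurable_angle.
by apply/funext => x /=; rewrite to_circleB !angleK.
Qed.

Lemma measurable_circleD d (X : measurableType d) (f g : X -> circle R) :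
  measurable_fun setT f -> measurable_fun setT g ->
  measurable_fun setT (fun x => f x + g x).
Proof.
move=> mf mg; rewrite (_ : (fun x => _) = (fun x => f x - (0 - g x))).
  by apply: measurable_circleB => //; exact: measurable_circleB.
by apply/funext => x; rewrite sub0r opprK.
Qed.

Lemma lebesgue_circleE C :
  lebesgue_circle C = leb (to_circle @^-1` C `&` `[0, 1[).
Proof. by []. Qed.

(** Haar measure can be computed on a fundamental domain with any cut point:
    the part that leaves [0, 1) comes back by translation by 1.  This cut is the
    image of [0, 1) under the reflection x |-> c - x. *)
Lemma lebesgue_circle_cut c C : measurable C -> lebesgue_circle C =
  leb (to_circle @^-1` C `&` `]angle c - 1, angle c]).
Proof.
move=> mC; have mP := measurable_preim mC; set P := to_circle @^-1` C in mP *.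
have [a0 a1] : 0 <= angle c /\ angle c < 1 by apply/andP/angle_itv.
set a := angle c in a0 a1 *.
have mI (i : interval R) : measurable (P `&` [set` i]).
  by apply: measurableI => //; exact: measurable_itv.
rewrite lebesgue_circleE -/P.
have -> : P `&` `[0, 1[ = (P `&` `[0, a]) `|` (P `&` `]a, 1[).
  rewrite -setIUr -itv_bndbnd_setU// bnd_simp//.
have -> : P `&` `]a - 1, a] = (P `&` `]a - 1, 0[) `|` (P `&` `[0, a]).
  rewrite -setIUr -itv_bndbnd_setU// bnd_simp//; lra.
have disj (A B : set R) : A `&` B = set0 -> P `&` A `&` (P `&` B) = set0.
  by move=> AB; rewrite setIACA AB setI0.
rewrite measureU//; [|exact: mI|exact: mI|]; last first.
  by apply: disj; apply/seteqP; split => // x /=; rewrite !in_itv/=; lra.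
rewrite measureU//; [|exact: mI|exact: mI|]; last first.
  by apply: disj; apply/seteqP; split => // x /=; rewrite !in_itv/=; lra.
rewrite addeC; congr (_ + _)%E.
rewrite (_ : P `&` `]a - 1, 0[ = (fun x => 1 * x + 1) @^-1` (P `&` `]a, 1[)).
  have := lebesgue_measure_affine 1 (oner_neq0 R) (mI `]a, 1[).
  by rewrite normr1 invr1 mul1e => /esym.
have PD1 x : P (1 * x + 1) = P x.
  by rewrite /P /= mul1r (_ : x + 1 = x + 1%:~R)// to_circleDz.
apply/seteqP; split => x /=; rewrite PD1 !in_itv/= => -[Px /andP[? ?]];
  split => //; lra.
Qed.

Lemma lebesgue_circle_reflect c C : measurable C ->
  lebesgue_circle [set y | C (c - y)] = lebesgue_circle C.
Proof.
move=> mC; rewrite [RHS](lebesgue_circle_cut c)//.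
have mP : measurable (to_circle @^-1` C `&` `]angle c - 1, angle c]).
  by apply: measurableI => //; exact: measurable_preim.
transitivity (leb ((fun x => - 1 * x + angle c) @^-1`
    (to_circle @^-1` C `&` `]angle c - 1, angle c]))); last first.
  by rewrite lebesgue_measure_affine ?oppr_eq0// normrN1 invr1 mul1e.
rewrite lebesgue_circleE; congr (leb _).
have E x : to_circle (- 1 * x + angle c) = c - to_circle x.
  by rewrite mulN1r addrC to_circleB angleK.
apply/seteqP; split => x /=; rewrite E !in_itv/= => -[? /andP[? ?]];
  split => //; lra.
Qed.

(** A translation is a product of two reflections. *)
Lemma lebesgue_circle_translate c C : measurable C ->
  lebesgue_circle [set y | C (y + c)] = lebesgue_circle C.
Proof.
move=> mC; have mC' : measurable [set y | C (0 - y)].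
  rewrite -[X in measurable X]setTI.
  by apply: measurable_circleB => //; exact: measurable_id.
rewrite -[RHS](lebesgue_circle_reflect 0)// -[RHS](lebesgue_circle_reflect (- c))//.
by congr (lebesgue_circle _); apply/seteqP; split => y /=;
  rewrite !opprD !opprK add0r addrC ?(addrC c).
Qed.

Lemma lebesgue_circle_open_gt0 W : open W -> W !=set0 -> (0 < lebesgue_circle W)%E.
Proof.
move=> oW [y Wy].
have [a0 a1] : 0 <= angle y /\ angle y < 1 by apply/andP/angle_itv.
have : nbhs (angle y) (to_circle @^-1` W).
  by apply: open_nbhs_nbhs; split; [exact: oW|rewrite /= angleK].
move=> /nbhs_ballP[e /= e0 eW].
pose b := Num.min (angle y + e) 1.
have ab : angle y < b by rewrite lt_min a1 andbT ltrDl.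
have be : b <= angle y + e by rewrite ge_min lexx.
have b1 : b <= 1 by rewrite ge_min lexx orbT.
apply: (@lt_le_trans _ _ (leb `]angle y, b[)).
  by rewrite lebesgue_measure_itv/= lte_fin ab -EFinB lte_fin subr_gt0.
have mW : measurable W by exact: sub_sigma_algebra.
rewrite lebesgue_circleE; apply: le_measure.
- by rewrite inE; exact: measurable_itv.
- by rewrite inE; apply: measurableI; [exact: measurable_preim|exact: measurable_itv].
- move=> x /=; rewrite !in_itv/= => /andP[yx xb]; split; last by lra.
  by apply: eW; rewrite /ball /= ltr_distlC; lra.
Qed.

End circle_measure.

(** * Unique ergodicity and minimality of irrational skew translations *)

Section torus_measure.
Context {R : realType}.
Local Notation torus := (circle R * circle R)%type.
Local Notation haar := (@lebesgue_circle R).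
Implicit Types (C D : set (circle R)) (A : set torus).

Lemma torus_measure_unique (m1 m2 : {measure set torus -> \bar R}) :
  (m1 setT < +oo)%E ->
  (forall C D, measurable C -> measurable D -> m1 (C `*` D) = m2 (C `*` D)) ->
  forall A, measurable A -> m1 A = m2 A.
Proof.
move=> m1oo m12.
apply: (measure_unique [set C `*` D | C in measurable & D in measurable]
  (fun=> setT)) => //.
- by rewrite measurable_prod_measurableType; congr (<<s _ >>).
- move=> _ _ [C mC [D mD <-]] [C' mC' [D' mD' <-]]; rewrite -setXI.
  by exists (C `&` C'); [exact: measurableI|exists (D `&` D') => //; exact: measurableI].
- by move=> _; exists setT => //; exists setT => //; rewrite setXTT.
- by rewrite bigcup_const.
- by move=> _ [C mC [D mD <-]]; exact: m12.
Qed.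

(** Fubini: each fibre map preserves Haar measure, so the fibre over y
    contributes either 0 or the full measure of D. *)
Lemma lebesgue_torus_fibred (t : circle R -> circle R)
    (u : circle R -> circle R -> circle R) C D :
  measurable_fun setT t ->
  (forall y, haar (u y @^-1` D) = haar D) ->
  measurable C -> measurable D ->
  lebesgue_torus [set p | C (t p.1) /\ D (u p.1 p.2)] =
  (haar (t @^-1` C) * haar D)%E.
Proof.
move=> mt uD mC mD.
have mtC : measurable (t @^-1` C) by rewrite -[X in measurable X]setTI; exact: mt.
have -> : lebesgue_torus [set p | C (t p.1) /\ D (u p.1 p.2)] =
    (\int[haar]_(y in t @^-1` C) (cst (haar D) y))%E.
  rewrite integral_mkcond; apply: eq_integral => y _ /=.
  rewrite patchE; have [Cy|nCy] := pselect (C (t y)).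
    rewrite mem_set// /cst -(uD y); congr (haar _); apply/seteqP; split => z;
      by rewrite /xsection /= inE/=; tauto.
  rewrite memNset// (_ : xsection _ _ = set0) ?measure0//.
  by apply/seteqP; split => // z; rewrite /xsection /= inE/= => -[].
by rewrite integral_cst// muleC.
Qed.

Lemma lebesgue_torusX C D : measurable C -> measurable D ->
  lebesgue_torus (C `*` D) = (haar C * haar D)%E.
Proof. exact: product_measure1E. Qed.

Lemma measurable_skew_shift al be : measurable_fun setT (@skew_shift R al be).
Proof.
apply/measurable_fun_pairP; split => /=.
  by apply: measurable_circleD; [exact: measurable_fst|exact: measurable_cst].
apply: measurable_circleB; last exact: measurable_cst.
by apply: measurable_circleD; [exact: measurable_snd|exact: measurable_fst].
Qed.

Lemma skew_shift_preserving al be :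
  measure_preserving lebesgue_torus (@skew_shift R al be).
Proof.
have mT := measurable_skew_shift al be.
split=> // A mA.
apply: (@torus_measure_unique
  (measure_function_pushforward__canonical__measure_function_Measure lebesgue_torus mT)
   lebesgue_torus _ _ A mA).
  by have /= := probability_setT (@lebesgue_torus R);
    rewrite /pushforward preimage_setT => ->; rewrite ltry.
move=> C D mC mD; rewrite [RHS](lebesgue_torusX mC mD).
rewrite -[haar C](lebesgue_circle_translate (to_circle al) mC).
apply: (@lebesgue_torus_fibred (fun y => y + to_circle al)
  (fun y z => z + y - to_circle be)) => //.
  by apply: measurable_circleD; [exact: measurable_id|exact: measurable_cst].
move=> y; rewrite -[RHS](lebesgue_circle_translate (y - to_circle be))//.
by congr (haar _); apply/funext => z /=; rewrite addrA.
Qed.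

Lemma lebesgue_torus_box_gt0 q : @box R q !=set0 ->
  (0 < @lebesgue_torus R (box q))%E.
Proof.
move=> [[y z] [/= cy cz]].
rewrite lebesgue_torusX; [|by apply: sub_sigma_algebra; exact: open_cap..].
by apply: mule_gt0; apply: lebesgue_circle_open_gt0;
  [exact: open_cap|exists y|exact: open_cap|exists z].
Qed.

Section irrational.
Variables al be : R.
Hypothesis al_irr : forall m n : int, m != 0 -> m%:~R * al != n%:~R.

Lemma skew_shift_uniquely_ergodic : uniquely_ergodic R (@skew_shift R al be).
Proof.
exists lebesgue_torus; first exact: skew_shift_preserving.
move=> nu nuT; apply: eq_trig_integral => F tF.
apply: (eq_mean al_irr) tF.
- exact: (trig_mean_integral nuT).
- exact: (trig_mean_integral (skew_shift_preserving al be)).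
Qed.

(** If the orbit of x missed O, it would miss a box inside O.  The approximants
    of this box would then be at most 1 / (n + 1) along the orbit, hence have
    integral at most 1 / (n + 1), as the mean along the orbit is the integral;
    but these integrals tend to the measure of the box. *)
Lemma skew_shift_minimal : minimal (@skew_shift R al be).
Proof.
move=> x O [p Op] oO; apply: contrapT => nO.
have [q [qp qO]] := nbhs_box (open_nbhs_nbhs (conj oO Op)).
have [F [tF F01 F0 F1]] := @trig_approx_box R q.
have mq : measurable (@box R q).
  by rewrite measurable_torusE; apply: sub_sigma_algebra; exact: open_box.
have [L mL Lle] := trig_mean_birkhoff al be x.
have cF := trig_approx_integral (nu := lebesgue_torus) mq tF F01 F0 F1.
have Fle n : \int[lebesgue_torus]_p F n p <= n.+1%:R^-1.
  rewrite -(eq_mean al_irr mL (trig_mean_integral (skew_shift_preserving al be)) (tF n)).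
  apply: Lle => // k; apply: F0 => /qO Ok.
  by apply: nO; exists (iter k (skew_shift al be) x); split => //; exists k.
have := lebesgue_torus_box_gt0 (ex_intro _ _ qp).
rewrite -[X in (_ < X)%E]fineK ?fin_num_measure// lte_fin ltNge => /negP; apply.
apply: (ler_cvg_to cF (@cvg_harmonic R)).
by apply: nearW => n; exact: Fle.
Qed.

End irrational.

End torus_measure.

(** * Renormalization at the golden mean *)

Section return_time.
Context {T : Type} (f : T -> T) (A : set T).

Lemma return_timeE n y : (0 < n)%N -> A (iter n f y) ->
  (forall m, (0 < m < n)%N -> ~ A (iter m f y)) -> return_time f A y = n.
Proof.
move=> n0 An nA; apply: xget_unique; first split => //.
- by move=> m m0 Am; rewrite leqNgt; apply/negP => mn; apply: (nA m); rewrite ?m0.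
- move=> m [m0 Am mle]; apply/eqP; rewrite eqn_leq mle//= leqNgt.
  by apply/negP => mn; apply: (nA m); rewrite ?m0.
Qed.

End return_time.

Section golden.
Context {R : realType}.
Local Notation torus := (circle R * circle R)%type.
Local Notation haar := (@lebesgue_circle R).
Local Notation phi := (golden R).
Implicit Types (u v y : R) (w z : circle R) (p : torus) (C D : set (circle R)).

Lemma golden_sqr : phi ^+ 2 = phi + 1.
Proof.
have s5 : Num.sqrt 5 ^+ 2 = 5 :> R by rewrite sqr_sqrtr.
by rewrite /golden; field: s5.
Qed.

Lemma golden_bounds : 3 / 2 < phi < 5 / 3.
Proof.
have p0 : 0 < phi by rewrite /golden divr_gt0// ltr_pwDl// sqrtr_ge0.
have := golden_sqr; move: p0; set f := phi => f0 f2; apply/andP; split; nra.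
Qed.

Lemma golden_neq0 : phi != 0.
Proof. by have /andP[? _] := golden_bounds; rewrite gt_eqF//; lra. Qed.

Definition alpha : R := 2 - phi.
Definition beta : R := phi - 3 / 2.

Lemma golden_skewE : @golden_skew R = skew_shift alpha beta.
Proof.
have f2 := golden_sqr; have f0 := golden_neq0.
have E1 : 1 / phi ^+ 2 = alpha.
  apply: (mulIf (expf_neq0 2 f0)); rewrite div1r mulVf ?expf_neq0// /alpha; ring: f2.
have E2 : 1 / (2 * phi ^+ 3) = beta.
  have n0 : 2 * phi ^+ 3 != 0 by rewrite mulf_neq0 ?expf_neq0.
  apply: (mulIf n0); rewrite div1r mulVf// /beta.
  have -> : phi ^+ 3 = 2 * phi + 1 by ring: f2.
  lra.
by apply/funext => p; rewrite /golden_skew E1 E2.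
Qed.

(** If m (2 - phi) = n, then n / m is a root of X^2 - 3 X + 1, so that
    (2 n - 3 m)^2 = 5 m^2, where the two sides have 5-adic valuations of
    different parities. *)
Lemma alpha_irrational (m n : int) : m != 0 -> m%:~R * alpha != n%:~R.
Proof.
move=> m0; apply/negP => /eqP mn.
have f2 := golden_sqr.
have E : (2 * n - 3 * m) ^+ 2 = 5 * m ^+ 2 :> int.
  apply/eqP; rewrite -(eqr_int R) !(rmorphXn, rmorphB, rmorphM)/= -mn /alpha.
  apply/eqP; ring: f2.
have EN : (absz (2 * n - 3 * m)%R ^ 2 = 5 * absz m ^ 2)%N.
  by rewrite -abszX E abszM abszX.
have m_gt0 : (0 < absz m)%N by rewrite absz_gt0.
have := congr1 (logn 5) EN; rewrite lognM ?expn_gt0 ?m_gt0// !lognX.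
by rewrite (_ : logn 5 5 = 1)%N// => /(congr1 odd); rewrite oddD !oddM.
Qed.

(** Here phi - 1 = 1 / phi.  The strip is open on the left and closed on the
    right because the conjugacy u |-> (1 - u) / phi reverses orientation. *)
Definition strip : set torus := [set p | 0 < angle p.1 <= phi - 1].

(** With u = 1 - phi y, the fibre map z |-> G y - z conjugates the two systems
    when, modulo 1,
    G (y + alpha) - G y = u + y - 2 beta on the points of return time 1, and
    G (y + 2 alpha - 1) - G y = u + 2 y + alpha - 3 beta on those of return
    time 2.  For a quadratic G, the coefficients of y in the two equations force
    the leading coefficient - phi / 2, and this linear term then satisfies both
    constant terms. *)
Definition cobound y : R := - (phi / 2) * y ^+ 2 - (phi - 1) / 2 * y.

Definition into_strip p : torus :=
  let y := (1 - angle p.1) * (phi - 1) in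
  (to_circle y, to_circle (cobound y) - p.2).

Definition out_of_strip p : torus :=
  (to_circle (1 - phi * angle p.1), to_circle (cobound (angle p.1)) - p.2).

Lemma strip_to_circle y w : 0 < y <= phi - 1 -> strip (to_circle y, w).
Proof.
have /andP[f1 f2] := golden_bounds => /andP[y0 y1].
by rewrite /strip /= to_circleK ?y0//; lra.
Qed.

Lemma measurable_strip : measurable strip.
Proof.
rewrite (_ : strip = (angle \o fst) @^-1` `]0, phi - 1]); last first.
  by apply/seteqP; split => p /=; rewrite in_itv.
rewrite -[X in measurable X]setTI.
by apply: (measurableT_comp measurable_angle measurable_fst) => //; exact: measurable_itv.
Qed.

Lemma measurable_cobound : measurable_fun setT cobound.
Proof.
apply: measurable_funB; apply: measurable_funM => //.
Qed.

Lemma measurable_into_strip : measurable_fun setT into_strip.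
Proof.
have m1 : measurable_fun setT (fun p : torus => (1 - angle p.1) * (phi - 1)).
  apply: measurable_funM => //; apply: measurable_funB => //.
  exact: measurableT_comp measurable_angle measurable_fst.
apply/measurable_fun_pairP; split => /=.
  exact: measurableT_comp measurable_to_circle m1.
apply: measurable_circleB; last exact: measurable_snd.
apply: measurableT_comp; first exact: measurable_to_circle.
exact: measurableT_comp measurable_cobound m1.
Qed.

Lemma measurable_out_of_strip : measurable_fun setT out_of_strip.
Proof.
have m1 : measurable_fun setT (fun p : torus => angle p.1).
  exact: measurableT_comp measurable_angle measurable_fst.
apply/measurable_fun_pairP; split => /=.
  apply: (measurableT_comp measurable_to_circle).
  apply: measurable_funB; first exact: measurable_cst.
  by apply: measurable_funM => //; exact: measurable_cst.
apply: measurable_circleB; last exact: measurable_snd.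
apply: (measurableT_comp measurable_to_circle).
exact: measurableT_comp measurable_cobound m1.
Qed.

Lemma strip_into_strip p : strip (into_strip p).
Proof.
have /andP[f1 f2] := golden_bounds; have /andP[a0 a1] := angle_itv p.1.
by apply: strip_to_circle; move: (angle p.1) a0 a1 => a a0 a1; nra.
Qed.

Lemma into_stripK p : out_of_strip (into_strip p) = p.
Proof.
have /andP[f1 f2] := golden_bounds; have /andP[a0 a1] := angle_itv p.1.
have fs := golden_sqr.
case: p a0 a1 => u w /= a0 a1; rewrite /out_of_strip /into_strip /=.
set y := _ * (phi - 1); have y01 : 0 <= y < 1 by rewrite /y; nra.
rewrite to_circleK// subKr; congr (_, _).
rewrite (_ : 1 - phi * y = angle u) ?angleK// /y; ring: fs.
Qed.

Lemma out_of_stripK p : strip p -> into_strip (out_of_strip p) = p.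
Proof.
have /andP[f1 f2] := golden_bounds; have fs := golden_sqr.
case: p => y w; rewrite /strip /out_of_strip /into_strip /= => /andP[y0 y1].
rewrite to_circleK; last first.
  by move: (angle y) y0 y1 => a a0 a1; apply/andP; split; nra.
have -> : (1 - (1 - phi * angle y)) * (phi - 1) = angle y by ring: fs.
by rewrite angleK subKr.
Qed.

Lemma skew_shift_to_circle al be y w :
  skew_shift al be (to_circle y, w) =
  (to_circle (y + al), w + to_circle (y - be)).
Proof. by rewrite /skew_shift /= to_circleD to_circleB addrA. Qed.

(** Here 2 phi - 3 = 1 / phi - alpha is the length of the part of the strip that
    the rotation keeps inside. *)
Lemma return_short y w : 0 < y <= 2 * phi - 3 ->
  return_time (skew_shift alpha beta) strip (to_circle y, w) = 1%N.
Proof.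
have /andP[f1 f2] := golden_bounds => /andP[y0 y1].
apply: return_timeE => //; last by case => [|[]].
by rewrite iterS /= skew_shift_to_circle; apply: strip_to_circle; rewrite /alpha; lra.
Qed.

(** The rotation moves these points into the complement of the strip, an arc
    of length alpha, and the next step brings them back. *)
Lemma return_long y w : 2 * phi - 3 < y <= phi - 1 ->
  return_time (skew_shift alpha beta) strip (to_circle y, w) = 2%N.
Proof.
have /andP[f1 f2] := golden_bounds => /andP[y0 y1].
apply: return_timeE => //.
  rewrite 2!iterS /= !skew_shift_to_circle.
  rewrite (_ : y + alpha + alpha = (y + 2 * alpha - 1) + 1%:~R); last by ring.
  by rewrite to_circleDz; apply: strip_to_circle; rewrite /alpha; lra.
case => [|[|//]]//= _; rewrite skew_shift_to_circle /strip /=.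
(* The right end point y = phi - 1 is sent to 0, which the strip excludes. *)
have [e1|e1] := eqVneq (y + alpha) 1.
  have -> : to_circle (y + alpha) = to_circle 0.
    by apply/to_circle_eqP; exists 1; rewrite e1 add0r.
  by rewrite to_circleK ?lexx ?ltr01// ltxx.
rewrite to_circleK; last by move: e1; rewrite /alpha neq_lt; lra.
by rewrite /alpha; lra.
Qed.

Lemma first_return_short y w : 0 < y <= 2 * phi - 3 ->
  first_return (skew_shift alpha beta) strip (to_circle y, w) =
  (to_circle (y + alpha), w + to_circle (y - beta)).
Proof.
by move=> y01; rewrite /first_return return_short// iterS skew_shift_to_circle.
Qed.

Lemma first_return_long y w : 2 * phi - 3 < y <= phi - 1 ->
  first_return (skew_shift alpha beta) strip (to_circle y, w) =
  (to_circle (y + 2 * alpha - 1), w + to_circle (2 * y + alpha - 2 * beta)).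
Proof.
move=> y01; rewrite /first_return return_long// 2!iterS !skew_shift_to_circle.
rewrite -(addrA w) -to_circleD; congr (_, w + to_circle _); last by ring.
by apply/to_circle_eqP; exists 1; ring.
Qed.

Lemma strip_first_return p : strip p ->
  return_domain (skew_shift alpha beta) strip p /\
  strip (first_return (skew_shift alpha beta) strip p).
Proof.
have /andP[f1 f2] := golden_bounds.
move=> Ap; suff [n [n0 Sn rn]] : exists n, [/\ (0 < n)%N,
    return_time (skew_shift alpha beta) strip p = n &
    strip (iter n (skew_shift alpha beta) p)].
  by split; [split => //; exists n; rewrite n0|rewrite /first_return Sn].
case: p Ap => c w /andP[/= y0 y1]; rewrite -(angleK c).
move: (angle c) y0 y1 => y y0 y1.
have [ys|yl] := leP y (2 * phi - 3).
  exists 1%N; have R1 : 0 < y <= 2 * phi - 3 by rewrite y0.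
  split => //; first exact: return_short.
  have := first_return_short w R1; rewrite /first_return return_short// => ->.
  by apply: strip_to_circle; rewrite /alpha; lra.
exists 2%N; have R2 : 2 * phi - 3 < y <= phi - 1 by rewrite yl.
split => //; first exact: return_long.
have := first_return_long w R2; rewrite /first_return return_long// => ->.
by apply: strip_to_circle; rewrite /alpha; lra.
Qed.

Lemma into_strip_conj p :
  into_strip (skew_shift alpha beta p) =
  first_return (skew_shift alpha beta) strip (into_strip p).
Proof.
have /andP[f1 f2] := golden_bounds; have fs := golden_sqr.
case: p => c w; have /andP[u0 u1] := angle_itv c.
rewrite -{1}(angleK c) skew_shift_to_circle /into_strip /=.
move: (angle c) u0 u1 => u u0 u1; set y := (1 - u) * (phi - 1).
(* The points of return time 2 are the images of those that the rotation by
   alpha does not carry past 1; in both cases the fibre coordinates of the two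
   sides differ by the integer -1. *)
have uE : u = 1 - phi * y by rewrite /y; ring: fs.
have [ul|ug] := ltP u (phi - 1).
  have y0 : 2 * phi - 3 < y by rewrite /y; nra.
  have y1 : y <= phi - 1 by rewrite /y; nra.
  rewrite first_return_long ?y0// to_circleK; last by rewrite /alpha; lra.
  have -> : (1 - (u + alpha)) * (phi - 1) = y + 2 * alpha - 1.
    by rewrite /y /alpha; ring: fs.
  congr (_, _).
  rewrite opprD addrCA [RHS]addrAC [LHS]addrC -to_circleB -to_circleD.
  congr (_ + _); apply/to_circle_eqP; exists (-1).
  by rewrite uE /cobound /alpha /beta; field: fs.
have y0 : 0 < y by rewrite /y; nra.
have y1 : y <= 2 * phi - 3 by rewrite /y; nra.
rewrite first_return_short ?y0//.
have -> : to_circle (u + alpha) = to_circle (u + alpha - 1).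
  by apply/to_circle_eqP; exists 1; rewrite subrK.
rewrite to_circleK; last by rewrite /alpha; lra.
have -> : (1 - (u + alpha - 1)) * (phi - 1) = y + alpha.
  by rewrite /y /alpha; ring: fs.
congr (_, _).
rewrite opprD addrCA [RHS]addrAC [LHS]addrC -to_circleB -to_circleD.
congr (_ + _); apply/to_circle_eqP; exists (-1).
by rewrite uE /cobound /alpha /beta; field: fs.
Qed.

(** The base conjugacy is affine of slope - (phi - 1) = - 1 / phi. *)
Lemma lebesgue_circle_contract C : measurable C ->
  haar [set w | C (to_circle ((1 - angle w) * (phi - 1)))] =
  (phi%:E * haar (C `&` [set w | 0 < angle w <= phi - 1]%R))%E.
Proof.
have /andP[f1 f2] := golden_bounds => mC.
set P := to_circle @^-1` C : set R.
have mP : measurable (P `&` `]0, phi - 1]).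
  apply: measurableI; last exact: measurable_itv.
  by rewrite -[X in measurable X]setTI; exact: measurable_to_circle.
have s0 : - (phi - 1) != 0 by rewrite oppr_eq0 gt_eqF//; lra.
have -> : haar (C `&` [set w | 0 < angle w <= phi - 1]) =
    lebesgue_measure (P `&` `]0, phi - 1]).
  rewrite lebesgue_circleE; congr (lebesgue_measure _).
  apply/seteqP; split => x /=; rewrite !in_itv/=.
    by move=> [[Cx + x01]]; rewrite to_circleK.
  move=> [Cx /andP[x0 x1]].
  by rewrite to_circleK; [do !split => //|]; lra.
have -> : phi%:E = (`|- (phi - 1)|^-1)%:E.
  congr EFin; rewrite normrN gtr0_norm; last by lra.
  have n0 : phi - 1 != 0 by rewrite gt_eqF//; lra.
  by apply: (mulIf n0); rewrite mulVf//; ring: golden_sqr.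
rewrite -(lebesgue_measure_affine (phi - 1) s0 mP).
rewrite lebesgue_circleE; congr (lebesgue_measure _).
have aff x : - (phi - 1) * x + (phi - 1) = (1 - x) * (phi - 1) by ring.
apply/seteqP; split => x /=; rewrite aff !in_itv/=.
  move=> [+ x01]; rewrite to_circleK// => Cx; split => //.
  by move: x01 => /andP[? ?]; nra.
move=> [Cx /andP[? ?]]; have x01 : 0 <= x < 1 by nra.
by rewrite to_circleK.
Qed.

(** Both sides are finite measures of A; on rectangles the base contributes the
    factor phi and the fibre reflections preserve Haar measure. *)
Lemma lebesgue_torus_into_strip A : measurable A ->
  lebesgue_torus (into_strip @^-1` A) =
  (phi%:E * lebesgue_torus (A `&` strip))%E.
Proof.
have /andP[f1 f2] := golden_bounds.
have phi0 : 0 <= phi by lra.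
move=> mA; apply: (@torus_measure_unique _
  (measure_function_pushforward__canonical__measure_function_Measure
    lebesgue_torus measurable_into_strip)
  (mscale (NngNum phi0) (mrestr lebesgue_torus measurable_strip)) _ _ A mA).
  by have /= := probability_setT (@lebesgue_torus R);
    rewrite /pushforward preimage_setT => ->; rewrite ltry.
move=> C D mC mD.
change (lebesgue_torus (into_strip @^-1` (C `*` D)) =
  (phi%:E * lebesgue_torus ((C `*` D) `&` strip))%E).
set I := [set w : circle R | 0 < angle w <= phi - 1].
have mI : measurable I.
  rewrite (_ : I = angle @^-1` `]0, phi - 1]).
    have := @measurable_angle R measurableT _ (measurable_itv `]0, phi - 1]).
    by rewrite setTI.
  by apply/seteqP; split => y /=; rewrite in_itv.
have -> : (C `*` D) `&` strip = (C `&` I) `*` D.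
  by apply/seteqP; split => p /= [] []; tauto.
rewrite (lebesgue_torusX (measurableI _ _ mC mI) mD) muleA.
rewrite -(lebesgue_circle_contract mC).
apply: (@lebesgue_torus_fibred _
  (fun w => to_circle ((1 - angle w) * (phi - 1)))
  (fun w z => to_circle (cobound ((1 - angle w) * (phi - 1))) - z)) => //.
  apply: (measurableT_comp measurable_to_circle); apply: measurable_funM => //.
  by apply: measurable_funB; [exact: measurable_cst|exact: measurable_angle].
by move=> w; exact: lebesgue_circle_reflect.
Qed.

Lemma lebesgue_torus_strip : lebesgue_torus strip = phi^-1%:E.
Proof.
have := lebesgue_torus_into_strip measurableT.
have T1 := probability_setT (@lebesgue_torus R).
rewrite preimage_setT T1 setTI => E.
by rewrite -[LHS]mul1e -(mulVf golden_neq0) EFinM -muleA -E mule1.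
Qed.

Lemma golden_self_induced : self_induced (@lebesgue_torus R) (@golden_skew R).
Proof.
have /andP[f1 f2] := golden_bounds.
rewrite golden_skewE; split; first exact: skew_shift_preserving.
exists strip, measurable_strip; split.
  rewrite lebesgue_torus_strip probability_setT !lte_fin invr_gt0 invf_lt1; lra.
have nE B : mnormalize (mrestr lebesgue_torus measurable_strip) lebesgue_torus B =
    (lebesgue_torus (B `&` strip) * phi%:E)%E.
  have mnormalizeE (m : {measure set torus -> \bar R}) : m setT = phi^-1%:E ->
      mnormalize m lebesgue_torus B = (m B * phi%:E)%E.
    move=> mT; rewrite /mnormalize mT /= eqe invr_eq0 (negbTE golden_neq0) /=.
    by rewrite invrK.
  apply: mnormalizeE; rewrite -lebesgue_torus_strip -[strip in RHS]setTI.
  by [].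
exists setT, strip, into_strip, out_of_strip; split.
- split; split => //.
  + by rewrite setCT measure0.
  + exact: measurable_strip.
  + by move=> p /strip_first_return [].
  + by apply: etrans (nE _) _; rewrite setICl measure0 mul0e.
  + by move=> p /strip_first_return [].
- by split => // p _; exact: strip_into_strip.
- by split => [p _|p]; [exact: into_stripK|exact: out_of_stripK].
- split; first exact: measurable_into_strip.
  exact: measurable_funS measurable_out_of_strip.
- split => [B mB|p _]; last exact: into_strip_conj.
  rewrite setTI; apply: etrans (esym (nE B)); rewrite muleC.
  exact: lebesgue_torus_into_strip.
Qed.

End golden.

Theorem proposition2 (R : realType) :
  [/\ self_induced (@lebesgue_torus R) (@golden_skew R),
      minimal (@golden_skew R) &
      uniquely_ergodic R (@golden_skew R)].
Proof.
split; first exact: golden_self_induced.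
- by rewrite golden_skewE; apply: skew_shift_minimal; exact: alpha_irrational.
- by rewrite golden_skewE; apply: skew_shift_uniquely_ergodic; exact: alpha_irrational.
Qed.
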